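(* Let $\mathbb{K}$ be $\mathbb{R}$ or $\mathbb{C}$, let $E$ be a $\mathbb{K}$-vector space of finite dimension $n\ge 1$, and let $u$ be an endomorphism of $E$ whose characteristic polynomial $\chi_u$ splits over $\mathbb{K}$: up to the sign $(-1)^n$, $\chi_u=\prod_{i=1}^r (X-\lambda_i)^{\alpha_i}$ with $\lambda_i\in\mathbb{K}$ pairwise distinct and $\alpha_i\ge 1$. Let $P=\prod_{i=1}^r (X-\lambda_i)$, and let $U,V\in\mathbb{K}[X]$ be polynomials such that $UP+VP'=1$. Define a sequence $(Q_m)_{m\ge 0}$ in $\mathbb{K}[X]$ by $$Q_0=X-PV,\qquad Q_{m+1}=Q_0\circ r(Q_m)\quad (m\ge 0),$$ where $r(Q_m)$ denotes the remainder of the Euclidean division of $Q_m$ by $\chi_u$. Then the sequence $(Q_m)$ is stationary from some rank on, and its eventual value $Q$ is a solution (which is unique modulo $\chi_u$) of the system of congruences $$Q\equiv \lambda_i \pmod{(X-\lambda_i)^{\alpha_i}},\qquad 1\le i\le r.$$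
   Context: The characteristic polynomial is $\chi_u=\det(u-X\,\mathrm{Id})$. $P'$ denotes the derivative of $P$, and $F\circ G$ denotes the composition $F(G(X))$ of polynomials. The polynomial $P$ equals, up to sign, $\chi_u/\gcd(\chi_u,\chi_u')$, where the gcd is taken monic; $P$ and $P'$ are coprime, so $U,V$ as in the claim exist. *)

(* Defs.v *)
From HB Require Import structures.
From mathcomp Require Import all_boot all_order all_algebra.
From mathcomp Require Import reals complex.

Set Implicit Arguments.
Unset Strict Implicit.
Unset Printing Implicit Defensive.

Import GRing.Theory passmx.
Local Open Scope ring_scope.

(* [R] is a model of the real numbers (unique up to isomorphism), so the two
   constructors give the field of real numbers and the field of complex
   numbers. *)
Variant real_or_complex (R : realType) : fieldType -> Prop :=
  | Real_case : real_or_complex R R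
  | Complex_case : real_or_complex R R[i].

Section CharPolyEnd.
Variables (K : fieldType) (E : vectType K).

(* The sign convention is det (u - X Id), so [charpoly_end u] is
   (-1) ^ dim E times the monic [char_poly] of a matrix of [u].  [mxof] acts on
   row vectors, i.e. it is the transpose of the usual matrix of [u], which does
   not change the determinant; neither does the choice of the basis, see
   [charpoly_endE]. *)
Definition charpoly_end (u : 'End(E)) : {poly K} :=
  let e := vbasis {:E} in \det (map_mx polyC (mxof e e u) - 'X%:M).

Lemma charpoly_endE (e : (\dim {:E}).-tuple E) (u : 'End(E)) : basis_of {:E} e ->
  charpoly_end u = \det (map_mx polyC (mxof e e u) - 'X%:M).
Proof.
move=> be.
have bb := vbasisP {:E}.
rewrite /charpoly_end; set b := vbasis _ in bb *.
set C := mxof e b \1%VF; set D := mxof b e \1%VF.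
have DC : D *m C = 1%:M.
  by rewrite -mxof_comp// comp_lfun1l mxof1 // (basis_free bb).
have M : mxof b b u = D *m mxof e e u *m C.
  by rewrite -!mxof_comp// comp_lfun1l comp_lfun1r.
have DCX : map_mx polyC D *m map_mx polyC C = 1%:M by rewrite -map_mxM DC map_mx1.
have -> : map_mx polyC (mxof b b u) - 'X%:M =
  map_mx polyC D *m (map_mx polyC (mxof e e u) - 'X%:M) *m map_mx polyC C.
  rewrite mulmxBr mulmxBl M !map_mxM; congr (_ - _).
  by rewrite mul_mx_scalar -scalemxAl DCX scalemx1.
by rewrite !det_mulmx mulrAC -det_mulmx DCX det1 mul1r.
Qed.

End CharPolyEnd.

Definition congp (K : fieldType) (d p q : {poly K}) : bool := d %| p - q.

(* Q_0 = Q0 and Q_(m+1) = Q0 o (remainder of Q_m modulo chi); note that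
   [p \Po q] is p(q(X)). *)
Fixpoint rem_comp_seq (K : fieldType) (chi Q0 : {poly K}) (m : nat) : {poly K} :=
  if m is m'.+1 then Q0 \Po (rem_comp_seq chi Q0 m' %% chi) else Q0.

(* Main.v *)
Require Import Defs.
From HB Require Import structures.
From mathcomp Require Import all_boot all_order all_algebra.
From mathcomp Require Import reals complex.

Set Implicit Arguments.
Unset Strict Implicit.
Unset Printing Implicit Defensive.

Import GRing.Theory.
Local Open Scope ring_scope.

(** Put [Q0 = X - P V].  Since [P] kills each [lambda i], so does [Q0 - X], and
    [Q0' = 1 - (P V)' = U P - P V'] vanishes there too: every [lambda i] is a
    superattracting fixed point of [Q0], i.e. [(X - lambda i)^2] divides
    [Q0 - lambda i] ([newton_step_sqr]).  In fact [Q0] is the Newton map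
    [X - P / P'] with [V] in place of the inverse of [P'] modulo [P].

    Composing with [Q0] therefore squares the error: if [(X - lambda i)^k]
    divides [T - lambda i], then [(X - lambda i)^(2k)] divides
    [Q0 o T - lambda i].  Reducing modulo [chi] loses nothing up to the exponent
    [alpha i], so [Q_m] is congruent to [lambda i] modulo
    [(X - lambda i)^min(2^(m+1), alpha i)] ([rem_comp_seq_cong]).

    Once [2^(m+1)] exceeds all the [alpha i], [Q_m] solves the system of
    congruences.  By coprimality any two solutions agree modulo [chi]
    ([congruences_unique]), so all these [Q_m] have the same remainder, and
    [Q_(m+1) = Q0 o (Q_m mod chi)] no longer depends on [m]. *)

Section NewtonSequence.
Variable K : fieldType.
Implicit Types (c : K) (d p q P T U V chi : {poly K}).

(** A zero of [p] where [p'] also vanishes is at least double; the quotient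
    argument, unlike a Taylor expansion, is valid in every characteristic. *)
Lemma dvdp_XsubC_sqr c p :
  root p c -> root p^`() c -> ('X - c%:P) ^+ 2 %| p.
Proof.
rewrite -!dvdp_XsubCl => /dvdpP [q ->].
rewrite derivM derivXsubC mulr1 dvdp_addr => [qc|]; last exact: dvdp_mull.
by rewrite expr2 dvdp_mul.
Qed.

Lemma newton_step_sqr c P U V :
  root P c -> U * P + V * P^`() = 1 ->
  ('X - c%:P) ^+ 2 %| ('X - P * V) - c%:P.
Proof.
move=> Pc bezout; apply: dvdp_XsubC_sqr; move: Pc; rewrite /root => /eqP Pc.
  by rewrite !hornerE Pc mul0r subr0 subrr.
have bezout_c := congr1 (horner^~ c) bezout.
move: bezout_c; rewrite !hornerE Pc mulr0 add0r => bezout_c.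
rewrite !derivE !hornerE Pc mul0r addr0 subr0.
by rewrite [_.[c] * V.[c]]mulrC bezout_c subrr.
Qed.

(** Substituting [T] in [(X - c)^2 %| Q0 - c] shows that [Q0 o T - c] is a
    multiple of [(T - c)^2]. *)
Lemma comp_poly_doubles c Q0 T d :
  ('X - c%:P) ^+ 2 %| Q0 - c%:P -> d %| T - c%:P ->
  d ^+ 2 %| (Q0 \Po T) - c%:P.
Proof.
move=> /(dvdp_comp_poly T); rewrite !expr2 comp_polyM !comp_polyB comp_polyX.
rewrite !comp_polyC => sqrQ dT; apply: dvdp_trans sqrQ.
exact: dvdp_mul.
Qed.

Lemma dvdp_modp_sub d chi T p :
  d %| chi -> d %| T - p -> d %| (T %% chi) - p.
Proof.
move=> dchi dT.
have -> : T %% chi - p = (T - p) - T %/ chi * chi.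
  by rewrite [X in X - p - _](divp_eq T chi) addrAC [_ + T %% chi]addrC addrK.
by rewrite dvdp_sub // dvdp_mull.
Qed.

Lemma rem_comp_seq_cong c a chi Q0 m :
  ('X - c%:P) ^+ a %| chi -> ('X - c%:P) ^+ 2 %| Q0 - c%:P ->
  ('X - c%:P) ^+ minn (2 ^ m.+1) a %| rem_comp_seq chi Q0 m - c%:P.
Proof.
move=> achi sqrQ; elim: m => [|m IHm] /=.
  by apply: dvdp_trans sqrQ; apply: dvdp_exp2l; rewrite expn1 geq_minl.
have rem_cong := dvdp_modp_sub
  (dvdp_trans (dvdp_exp2l _ (geq_minr _ _)) achi) IHm.
apply: dvdp_trans (comp_poly_doubles sqrQ rem_cong).
rewrite -exprM; apply: dvdp_exp2l.
rewrite [(2 ^ m.+2)%N]expnSr minnMl leq_min geq_minl /=.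
by rewrite (leq_trans (geq_minr _ _)) // leq_pmulr.
Qed.

Section Congruences.
Variables (r : nat) (lambda : 'I_r -> K) (alpha : 'I_r -> nat).
Hypothesis lambda_inj : injective lambda.

Lemma prod_XsubC_exp_dvdp p :
  (forall i, ('X - (lambda i)%:P) ^+ alpha i %| p) ->
  \prod_(i < r) ('X - (lambda i)%:P) ^+ alpha i %| p.
Proof.
move=> dvd_p; elim: (index_enum _) (index_enum_uniq 'I_r) => [|i s IHs] /=.
  by rewrite big_nil dvd1p.
case/andP=> i_notin_s s_uniq; rewrite big_cons Gauss_dvdp ?dvd_p ?IHs //.
rewrite big_seq; apply: (big_ind (coprimep _)) => [|p1 p2 c1 c2|j js].
- exact: coprimep1.
- by rewrite coprimepMr c1.
apply/coprimep_expl/coprimep_expr/coprimep_XsubC2.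
rewrite subr_eq0; apply: contraNneq i_notin_s => /lambda_inj <- //.
Qed.

Lemma congruences_unique p q :
  (forall i, ('X - (lambda i)%:P) ^+ alpha i %| p - (lambda i)%:P) ->
  (forall i, ('X - (lambda i)%:P) ^+ alpha i %| q - (lambda i)%:P) ->
  \prod_(i < r) ('X - (lambda i)%:P) ^+ alpha i %| p - q.
Proof.
move=> solp solq; apply: prod_XsubC_exp_dvdp => i.
have -> : p - q = (p - (lambda i)%:P) - (q - (lambda i)%:P).
  by rewrite opprB addrA subrK.
exact: dvdp_sub.
Qed.

End Congruences.

End NewtonSequence.

Theorem mainTheorem1 (R : realType) (K : fieldType)
    (hK : real_or_complex R K)
    (n : nat) (hn : (1 <= n)%N)
    (E : vectType K) (hE : \dim {:E} = n)
    (u : 'End(E))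
    (r : nat) (lambda : 'I_r -> K) (alpha : 'I_r -> nat)
    (hlambda : injective lambda)
    (halpha : forall i : 'I_r, (1 <= alpha i)%N)
    (hchi : charpoly_end u =
      (-1) ^+ n *: \prod_(i < r) ('X - (lambda i)%:P) ^+ alpha i)
    (P : {poly K}) (hP : P = \prod_(i < r) ('X - (lambda i)%:P))
    (U V : {poly K}) (hUV : U * P + V * P^`() = 1)
    (Q : nat -> {poly K})
    (hQ : Q = rem_comp_seq (charpoly_end u) ('X - P * V)) :
  exists Qlim : {poly K},
    [/\ exists N : nat, forall m : nat, (N <= m)%N -> Q m = Qlim,
        forall i : 'I_r,
          congp (('X - (lambda i)%:P) ^+ alpha i) Qlim (lambda i)%:P
      & forall T : {poly K},
          (forall i : 'I_r,
            congp (('X - (lambda i)%:P) ^+ alpha i) T (lambda i)%:P) ->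
          congp (charpoly_end u) T Qlim].
Proof.
set w := fun i : 'I_r => ('X - (lambda i)%:P) ^+ alpha i.
set chi := charpoly_end u in hchi hQ *; set Q0 := 'X - P * V in hQ.
have chi_dvd p : (chi %| p) = (\prod_(i < r) w i %| p).
  by rewrite hchi dvdpZl // signr_eq0.
have w_chi i : w i %| chi.
  by rewrite hchi dvdpZr ?signr_eq0 // (bigD1 i) //= dvdp_mulr.
have Q0_sqr i : ('X - (lambda i)%:P) ^+ 2 %| Q0 - (lambda i)%:P.
  apply: newton_step_sqr hUV.
  by rewrite -dvdp_XsubCl hP (bigD1 i) //= dvdp_mulr.
(* [N] is chosen so that [alpha i <= N < 2 ^ N] for all [i]. *)
pose N := \max_i alpha i.
have Q_sol m i : (N <= m)%N -> w i %| Q m - (lambda i)%:P.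
  move=> Nm; have := rem_comp_seq_cong m (w_chi i) (Q0_sqr i).
  rewrite -hQ (minn_idPr _) // (leq_trans (leq_bigmax i)) //.
  exact: leq_trans Nm (leq_trans (leqnSn m) (ltnW (ltn_expl _ _))).
have Q_mod m : (N <= m)%N -> Q m %% chi = Q N %% chi.
  move=> Nm; apply/eqP; rewrite -subr_eq0 -modpN -modpD; apply/eqP/modp_eq0.
  by rewrite chi_dvd; apply: congruences_unique => // i; apply: Q_sol.
exists (Q N.+1); split=> [|i|T Tsol].
- exists N.+1 => -[//|m] Nm.
  by rewrite hQ /= -hQ !Q_mod.
- exact: Q_sol.
by rewrite /congp chi_dvd; apply: congruences_unique => // i; apply: Q_sol.
Qed.
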